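(* Let $G=(V,E)$ be a finite graph with $V=\{v_1,\ldots,v_{|V|}\}$ and $E=\{e_1,\ldots,e_{|E|}\}$, and let $q\in\mathbb{Z}_+$. Index binary vectors by pairs $(v,e)\in V\times E$ and define $$\widetilde{\mathcal{I}}_X=\Big\{\mathbf{x}\in\{0,1\}^{V\times E}:\ \sum_{v\in V}x_{v,e}\le 1\ \ \forall e\in E\Big\},$$ $$\widetilde{\mathcal{I}}_Y(\mathbf{x})=\Big\{\mathbf{y}\in\{0,1\}^{V\times E}:\ \mathbf{y}\le \mathbf{1}-\mathbf{x},\ \sum_{e\in E}y_{v,e}\le 1\ \ \forall v\in V\Big\},$$ and the weight vector $\widetilde{\boldsymbol\beta}\in\{0,1\}^{V\times E}$ by $\widetilde\beta_{v,e}=1$ if the edge $e$ is incident to the vertex $v$ and $\widetilde\beta_{v,e}=0$ otherwise. Let $\widetilde q=|V|-q$. Then $G$ has an independent set $S\subseteq V$ (no two vertices of $S$ adjacent) with $|S|\ge q$ if and only if there exists $\mathbf{x}\in\widetilde{\mathcal{I}}_X$ such that $$\max_{\mathbf{y}\in\widetilde{\mathcal{I}}_Y(\mathbf{x})}\widetilde{\boldsymbol\beta}^\top\mathbf{y}\le \widetilde q.$$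
   Context: This is the reduction from the decision version of the maximum independent set problem to the decision version of the partition matroid interdiction problem: the leader's feasible set $\widetilde{\mathcal I}_X$ is a partition matroid with groups $L_k=\{(v,e_k):v\in V\}$ and capacities $1$, and the follower's feasible set is a partition matroid with groups $F_k=\{(v_k,e):e\in E\}$ and capacities $1$, with the leader's chosen elements removed. *)

(* Defs.v *)
From mathcomp Require Import all_boot.
Set Implicit Arguments.
Unset Strict Implicit.
Unset Printing Implicit Defensive.

(* A simple graph on V is given by its edge set E, a set of two-element
   subsets of V. *)
Definition simple_graph (V : finType) (E : {set {set V}}) : bool :=
  [forall e in E, #|e| == 2].

Definition adjacent (V : finType) (E : {set {set V}}) : rel V :=
  fun u v => [set u; v] \in E.

Definition independent (V : finType) (E : {set {set V}}) (S : {set V}) : bool :=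
  [forall u in S, forall v in S, ~~ adjacent E u v].

Notation edge E := {e | e \in E}.

(* Booleans are coerced to 0 and 1 in sums and inequalities. *)
Notation binvec V E := {ffun V * edge E -> bool}.

Definition leader_feasible (V : finType) (E : {set {set V}}) :
    {set binvec V E} :=
  [set x : binvec V E | [forall e : edge E, \sum_(v : V) x (v, e) <= 1]].

Definition follower_feasible (V : finType) (E : {set {set V}})
    (x : binvec V E) : {set binvec V E} :=
  [set y : binvec V E | [forall p : V * edge E, y p <= 1 - x p]
                     && [forall v : V, \sum_(e : edge E) y (v, e) <= 1]].

Definition beta (V : finType) (E : {set {set V}}) : binvec V E :=
  [ffun p : V * edge E => p.1 \in val p.2].

Definition follower_value (V : finType) (E : {set {set V}})
    (y : binvec V E) : nat :=
  \sum_(p : V * edge E) beta E p * y p.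

(* The follower's feasible set contains the zero vector, so the value 0 that
   \max takes on an empty range plays no role. *)
Definition follower_optimum (V : finType) (E : {set {set V}})
    (x : binvec V E) : nat :=
  \max_(y in follower_feasible x) follower_value y.

(* Main.v *)
(* Once the leader plays x, the follower's choices for distinct vertices do
   not interact: a vertex v contributes 1 exactly when some edge at v is left
   free by x. So the follower's optimum is the number of vertices that are not
   blocked, i.e. at which some incident edge is not taken by the leader. Since
   the leader may take each edge at one endpoint only, blocked vertices form
   an independent set, and every independent set can be blocked. *)
Require Import Defs.
From mathcomp Require Import all_boot all_order all_algebra.
From mathcomp Require Import zify.

Set Implicit Arguments.
Unset Strict Implicit.
Unset Printing Implicit Defensive.

(** Turns a capacity constraint of either matroid into uniqueness of the chosen element. *)
Lemma sum_bool_le1P (T : finType) (P : pred T) :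
  reflect (forall u v, P u -> P v -> u = v) (\sum_u P u <= 1).
Proof.
have -> : \sum_u P u = #|P|.
  rewrite -sum1_card [RHS]big_mkcond; apply: eq_bigr => u _.
  by rewrite unfold_in; case: (P u).
by apply: (iffP card_le1_eqP) => H u v Pu Pv; apply: H.
Qed.

(** An isolated vertex is blocked vacuously, which fits its contributing 0 to the follower. *)
Definition blocked (V : finType) (E : {set {set V}}) (x : binvec V E) :
    {set V} :=
  [set v | [forall e : edge E, (v \in val e) ==> x (v, e)]].

Lemma follower_valueE (V : finType) (E : {set {set V}}) (y : binvec V E) :
  follower_value y = \sum_v \sum_(e : edge E) (v \in val e) * y (v, e).
Proof.
by rewrite pair_bigA; apply: eq_bigr => -[v e] _; rewrite ffunE.
Qed.

Lemma follower_feasibleP (V : finType) (E : {set {set V}}) (x y : binvec V E) :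
  reflect ((forall p, y p -> ~~ x p) /\
           (forall v, \sum_(e : edge E) y (v, e) <= 1))
          (y \in follower_feasible x).
Proof.
rewrite inE; apply: (iffP andP) => -[H1 H2]; split.
- by move=> p yp; move/forallP/(_ p): H1; rewrite yp; case: (x p).
- exact/forallP.
- by apply/forallP => p; move: (H1 p); case: (y p) (x p) => -[] // /(_ isT).
- exact/forallP.
Qed.

Lemma follower_optimumE (V : finType) (E : {set {set V}}) (x : binvec V E) :
  follower_optimum x = #|~: blocked x|.
Proof.
have cardE : #|~: blocked x| = \sum_(v : V) (v \notin blocked x).
  rewrite -sum1_card big_mkcond; apply: eq_bigr => v _.
  by rewrite inE; case: ifP.
rewrite cardE; apply/eqP; rewrite eqn_leq; apply/andP; split.
  (* Upper bound, vertex by vertex: [y] avoids every edge at a blocked vertex, and elsewhere the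
     capacity allows at most 1. *)
  apply/bigmax_leqP => y /follower_feasibleP[yx y1].
  rewrite follower_valueE; apply: leq_sum => v _; rewrite inE.
  case: forallP => [Bv|_] /=.
    rewrite big1 // => e _; have /implyP Bve := Bv e.
    case: (boolP (v \in val e)) => // /Bve xve.
    by case: (boolP (y (v, e))) => // /yx; rewrite xve.
  apply: leq_trans (y1 v); apply: leq_sum => e _.
  by case: (v \in val e); rewrite ?mul1n.
(* An optimal reply: each vertex picks one free incident edge, if there is any. *)
pose free v := [pick e : edge E | (v \in val e) && ~~ x (v, e)].
pose y : binvec V E := [ffun p => free p.1 == Some p.2].
have y_feas : y \in follower_feasible x.
  apply/follower_feasibleP; split=> [[v e]|v].
    by rewrite ffunE /= /free; case: pickP => // e' /andP[_ xe'] /eqP[<-].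
  by apply/sum_bool_le1P => e1 e2; rewrite !ffunE /= => /eqP-> /eqP[].
apply: leq_trans (leq_bigmax_cond _ y_feas).
rewrite follower_valueE; apply: leq_sum => v _; rewrite inE negb_forall.
case: existsP => // -[e]; rewrite negb_imply => ve.
have [e' fe' /andP[ve' _]] :
    exists2 e', free v = Some e' & (v \in val e') && ~~ x (v, e').
  by rewrite /free; case: pickP => [e' He'|/(_ e)]; [exists e' | rewrite ve].
by rewrite (bigD1 e') //= ffunE /= fe' eqxx ve'.
Qed.

Lemma leader_feasibleP (V : finType) (E : {set {set V}}) (x : binvec V E) :
  reflect (forall e u v, x (u, e) -> x (v, e) -> u = v)
          (x \in leader_feasible E).
Proof.
rewrite inE; apply: (iffP forallP) => H e; exact/sum_bool_le1P/H.
Qed.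

Lemma adjacent_irreflexive (V : finType) (E : {set {set V}}) :
  simple_graph E -> irreflexive (adjacent E).
Proof.
move=> /forall_inP hG v; apply/negP => /hG.
by rewrite setUid cards1.
Qed.

(** An edge between two blocked vertices would be taken at both ends, so the leader's capacity would
    make it a loop. *)
Lemma blocked_independent (V : finType) (E : {set {set V}}) (x : binvec V E) :
  simple_graph E -> x \in leader_feasible E -> independent E (blocked x).
Proof.
move=> hG /leader_feasibleP x1.
apply/forall_inP => u; rewrite inE => /forallP Bu.
apply/forall_inP => v; rewrite inE => /forallP Bv; apply/negP => uv.
pose e : edge E := exist _ [set u; v] uv.
have xu : x (u, e) by apply: (implyP (Bu e)); rewrite set21.
have xv : x (v, e) by apply: (implyP (Bv e)); rewrite set22.
by have := uv; rewrite (x1 _ _ _ xu xv) adjacent_irreflexive.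
Qed.

(** The leader takes each edge at its endpoint in [S]; independence leaves at most one such
    endpoint. *)
Lemma independent_blocked (V : finType) (E : {set {set V}}) (S : {set V}) :
  simple_graph E -> independent E S ->
  exists2 x : binvec V E, x \in leader_feasible E & S \subset blocked x.
Proof.
move=> hG indS.
exists [ffun p : V * edge E => (p.1 \in S) && (p.1 \in val p.2)]; last first.
  apply/subsetP => v Sv; rewrite inE; apply/forallP => e.
  by rewrite ffunE /= Sv; apply/implyP.
apply/leader_feasibleP => e u v; rewrite !ffunE /=.
move=> /andP[Su ue] /andP[Sv ve]; apply/eqP; apply/negPn/negP => uv.
(* Two distinct endpoints exhaust a two-element edge, so [u] and [v] are adjacent. *)
have e_uv : [set u; v] = val e.
  apply/eqP; rewrite eqEcard subUset !sub1set ue ve cards2 uv.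
  by rewrite (eqP (forall_inP hG _ (valP e))).
have /forall_inP/(_ _ Su)/forall_inP/(_ _ Sv)/negP := indS; apply.
by rewrite /adjacent e_uv (valP e).
Qed.

Theorem theorem1 (V : finType) (E : {set {set V}}) (hG : simple_graph E)
    (q : nat) :
  (exists S : {set V}, independent E S /\ (q <= #|S|)%N) <->
  (exists x : binvec V E, x \in leader_feasible E /\
    ((follower_optimum x)%:Z <= #|V|%:Z - q%:Z)%R).
Proof.
(* The difference is taken in the integers, so for [q] above [#|V|] the bound is negative and both
   sides fail. *)
have cost (x : binvec V E) :
    ((follower_optimum x)%:Z <= #|V|%:Z - q%:Z)%R = (q <= #|blocked x|).
  by rewrite follower_optimumE; have := cardsC (blocked x); lia.
split=> [[S [indS qS]]|[x [xX]]].
  have [x xX Sx] := independent_blocked hG indS.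
  by exists x; rewrite cost (leq_trans qS (subset_leq_card Sx)).
by rewrite cost => qx; exists (blocked x); split=> //;
  apply: blocked_independent.
Qed.
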